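(* Let $D$ be a domain in $\mathbb{R}^n$, let $\alpha>0$, and let $f:D\to\mathbb{R}$ be a positive $\alpha$-Lipschitz function (that is, $f(x)>0$ and $|f(x)-f(y)|\le\alpha|x-y|$ for all $x,y\in D$). Then the expression $$i_{D,f}^*(x,y)=2\log\frac{f(x)+f(y)+\alpha|x-y|}{2\sqrt{f(x)f(y)}},\qquad x,y\in D,$$ defines a metric on $D$.
   Context: A domain is a nonempty open connected set; $|\cdot|$ is the Euclidean norm. *)

(* Defs.v *)
From HB Require Import structures.
From mathcomp Require Import all_boot all_order all_algebra.
From mathcomp Require Import all_classical all_reals all_analysis.

Set Implicit Arguments.
Unset Strict Implicit.
Unset Printing Implicit Defensive.

Import Order.TTheory GRing.Theory Num.Theory.
Import numFieldNormedType.Exports.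

Local Open Scope classical_set_scope.
Local Open Scope ring_scope.

(* The library norm `|x| on row vectors is the sup norm, so the Euclidean norm
   is defined separately. Both norms induce the same topology, hence [open] and
   [connected] below have their usual meaning in R^n. *)
Definition enorm (R : realType) (n : nat) (x : 'rV[R]_n) : R :=
  Num.sqrt (\sum_(i < n) x ord0 i ^+ 2).

Definition domain (R : realType) (n : nat) (D : set 'rV[R]_n) : Prop :=
  [/\ D !=set0, open D & connected D].

(* [f : D -> R] is defined on the subtype of points of D; [\val] is the
   inclusion of D into R^n. The library's [k.-lipschitz_A f] is not used, since
   it refers to the sup norm. *)
Definition elipschitz (R : realType) (n : nat) (D : set 'rV[R]_n)
    (alpha : R) (f : D -> R) : Prop :=
  forall x y : D, `|f x - f y| <= alpha * enorm (\val x - \val y).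

Definition is_metric (R : realType) (T : Type) (d : T -> T -> R) : Prop :=
  [/\ forall x y, 0 <= d x y,
      forall x y, d x y = 0 <-> x = y,
      forall x y, d x y = d y x
    & forall x y z, d x z <= d x y + d y z].

Definition istar (R : realType) (n : nat) (D : set 'rV[R]_n)
    (alpha : R) (f : D -> R) (x y : D) : R :=
  2 * ln ((f x + f y + alpha * enorm (\val x - \val y))
          / (2 * Num.sqrt (f x * f y))).

(* Main.v *)
Require Import Defs.
From mathcomp Require Import all_boot all_order all_algebra.
From mathcomp Require Import all_classical all_reals all_analysis.
From mathcomp Require Import ring lra.

Import Order.TTheory GRing.Theory Num.Theory.

Local Open Scope classical_set_scope.
Local Open Scope ring_scope.

(** Write [d x y = alpha * |x - y|]. This is a metric for which [f] is
    1-Lipschitz, and only this matters: on any metric space, a positive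
    1-Lipschitz [f] makes twice the logarithm of

      Q x y = (f x + f y + d x y) / (2 * sqrt (f x * f y))

    a metric ([log_ratio_metric]). By the inequality of arithmetic and geometric
    means [Q x y >= 1], with equality only if [d x y = 0], so the logarithm is
    nonnegative and separates points.

    The triangle inequality says that [Q x z <= Q x y * Q y z]. The square roots
    combine into [f y], so that with [a, b, c] the values of [f] at [x, y, z]
    this becomes

      2 b (a + c + d x z) <= (a + b + d x y) (b + c + d y z).

    Replacing [d x z] by the larger [d x y + d y z] and putting [p = a + d x y],
    [q = c + d y z], the right side minus the left side is [(p - b) (q - b)].
    Both factors are nonnegative precisely because [f] is 1-Lipschitz.

    That [d] is a metric comes down to the triangle inequality for the Euclidean
    norm ([enormD]), a consequence of the Cauchy-Schwarz inequality. *)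

(** * The Euclidean distance *)

Section EuclideanNorm.
Context (R : realType) (n : nat).
Implicit Types x y : 'rV[R]_n.

Lemma enorm_ge0 x : 0 <= enorm x.
Proof. exact: sqrtr_ge0. Qed.

Lemma sqr_enorm x : enorm x ^+ 2 = \sum_(i < n) x ord0 i ^+ 2.
Proof. by rewrite sqr_sqrtr// sumr_ge0// => i _; exact: sqr_ge0. Qed.

Lemma enorm0 : enorm (0 : 'rV[R]_n) = 0.
Proof. by rewrite /enorm big1 ?sqrtr0// => i _; rewrite mxE expr0n. Qed.

Lemma enorm_eq0 x : enorm x = 0 -> x = 0.
Proof.
move=> x0; have := sqr_enorm x; rewrite x0 expr0n /= => /esym sum0.
apply/rowP => i; rewrite mxE; apply/eqP; rewrite -sqrf_eq0.
by rewrite (psumr_eq0P _ sum0)// => j _; exact: sqr_ge0.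
Qed.

Lemma enormN x : enorm (- x) = enorm x.
Proof. by congr Num.sqrt; apply: eq_bigr => i _; rewrite mxE sqrrN. Qed.

(** The sum of the squares of the entries of [|y| x - |x| y] is nonnegative, and
    it equals [2 |x| |y| (|x| |y| - <x, y>)]. *)
Lemma enorm_cauchy_schwarz x y :
  \sum_(i < n) x ord0 i * y ord0 i <= enorm x * enorm y.
Proof.
have [xy_gt0|] := ltP 0 (enorm x * enorm y); last first.
  (* a vector of norm zero vanishes, and then so does the inner product *)
  move=> xy_le0; have /eqP : enorm x * enorm y = 0.
    by apply/le_anti; rewrite xy_le0 mulr_ge0 ?enorm_ge0.
  rewrite mulf_eq0 => /orP[]/eqP/enorm_eq0 ->; rewrite enorm0 ?(mul0r, mulr0).
    by rewrite big1// => i _; rewrite mxE mul0r.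
  by rewrite big1// => i _; rewrite mxE mulr0.
have : 0 <= \sum_(i < n) (enorm y * x ord0 i - enorm x * y ord0 i) ^+ 2.
  by apply: sumr_ge0 => i _; exact: sqr_ge0.
rewrite (eq_bigr (fun i => enorm y ^+ 2 * x ord0 i ^+ 2
  + enorm x ^+ 2 * y ord0 i ^+ 2
  - 2 * (enorm x * enorm y) * (x ord0 i * y ord0 i))); last by move=> i _; ring.
rewrite !big_split/= sumrN -!mulr_sumr -!sqr_enorm.
set S := \sum_(i < n) _; set A := enorm x in xy_gt0 *.
set B := enorm y in xy_gt0 *.
have -> : B ^+ 2 * A ^+ 2 + A ^+ 2 * B ^+ 2 - 2 * (A * B) * S
        = 2 * (A * B) * (A * B - S) by ring.
by rewrite pmulr_rge0 ?subr_ge0// mulr_gt0.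
Qed.

Lemma enormD x y : enorm (x + y) <= enorm x + enorm y.
Proof.
rewrite -ler_sqr ?nnegrE ?addr_ge0 ?enorm_ge0// sqr_enorm.
rewrite (eq_bigr (fun i => x ord0 i ^+ 2 + y ord0 i ^+ 2
  + 2 * (x ord0 i * y ord0 i))); last by move=> i _; rewrite mxE; ring.
rewrite !big_split/= -mulr_sumr -!sqr_enorm.
by have := enorm_cauchy_schwarz x y; lra.
Qed.

Lemma scaled_enorm_metric (D : set 'rV[R]_n) (alpha : R) : 0 < alpha ->
  is_metric (fun x y : D => alpha * enorm (\val x - \val y)).
Proof.
move=> alpha_gt0; split=> [x y|x y|x y|x y z].
- by rewrite mulr_ge0 ?enorm_ge0 ?ltW.
- split=> [/eqP|->]; last by rewrite subrr enorm0 mulr0.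
  rewrite mulf_eq0 gt_eqF//= => /eqP/enorm_eq0/eqP.
  by rewrite subr_eq0 => /eqP/val_inj.
- by rewrite -enormN opprB.
- rewrite -mulrDr ler_pM2l//.
  by have := enormD (\val x - \val y) (\val y - \val z); rewrite addrA subrK.
Qed.

End EuclideanNorm.

(** * The logarithmic metric of a positive 1-Lipschitz function *)

Section LogRatio.
Context {R : realType}.
Implicit Types a b c p q r : R.

Lemma sqrt_mulM a b c : 0 < a -> 0 < b ->
  Num.sqrt (a * b) * Num.sqrt (b * c) = b * Num.sqrt (a * c).
Proof.
move=> a_gt0 b_gt0; rewrite !sqrtrM ?(ltW a_gt0) ?(ltW b_gt0)//.
by rewrite -[in RHS](sqr_sqrtr (ltW b_gt0)); ring.
Qed.

Lemma ge1_log_ratio a b p : 0 < a -> 0 < b -> 0 <= p ->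
  1 <= (a + b + p) / (2 * Num.sqrt (a * b)).
Proof.
move=> a_gt0 b_gt0 p_ge0; have ab_gt0 := mulr_gt0 a_gt0 b_gt0.
rewrite ler_pdivlMr ?mulr_gt0 ?sqrtr_gt0// mul1r sqrtrM ?(ltW a_gt0)//.
have := sqr_ge0 (Num.sqrt a - Num.sqrt b).
rewrite sqrrB !sqr_sqrtr ?(ltW a_gt0) ?(ltW b_gt0)//; lra.
Qed.

Lemma log_ratio_eq1 a b p : 0 < a -> 0 < b -> 0 <= p ->
  (a + b + p) / (2 * Num.sqrt (a * b)) = 1 -> p = 0.
Proof.
move=> a_gt0 b_gt0 p_ge0 eq1.
have den_gt0 : 0 < 2 * Num.sqrt (a * b) by rewrite mulr_gt0 ?sqrtr_gt0 ?mulr_gt0.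
(* the ratio with p = 0 is already at least 1 *)
have := ge1_log_ratio a b 0 a_gt0 b_gt0 (lexx 0); rewrite -[leLHS]eq1.
by rewrite ler_pM2r ?invr_gt0//; lra.
Qed.

Lemma log_ratioM a b c p q r : 0 < a -> 0 < b -> 0 < c ->
  r <= p + q -> `|a - b| <= p -> `|b - c| <= q ->
  (a + c + r) / (2 * Num.sqrt (a * c)) <=
    (a + b + p) / (2 * Num.sqrt (a * b)) *
    ((b + c + q) / (2 * Num.sqrt (b * c))).
Proof.
move=> a_gt0 b_gt0 c_gt0 r_le; rewrite !ler_norml => /andP[p1 p2] /andP[q1 q2].
have s_gt0 : 0 < Num.sqrt (a * c) by rewrite sqrtr_gt0 mulr_gt0.
rewrite mulf_div mulrACA sqrt_mulM//.
have -> : (a + c + r) / (2 * Num.sqrt (a * c)) =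
    2 * b * (a + c + r) / (2 * 2 * (b * Num.sqrt (a * c))).
  by field; rewrite !gt_eqF.
rewrite ler_pM2r ?invr_gt0 ?mulr_gt0//.
have prod_ge0 : 0 <= (a + p - b) * (c + q - b) by rewrite mulr_ge0//; lra.
have : b * r <= b * (p + q) by rewrite ler_pM2l.
by move: prod_ge0; lra.
Qed.

Lemma log_ratio_metric (T : Type) (d : T -> T -> R) (f : T -> R) :
  is_metric d -> (forall x, 0 < f x) ->
  (forall x y, `|f x - f y| <= d x y) ->
  is_metric (fun x y =>
    2 * ln ((f x + f y + d x y) / (2 * Num.sqrt (f x * f y)))).
Proof.
move=> [d_ge0 d_eq0 dC d_triangle] f_gt0 f_lip.
have ratio_ge1 x y : 1 <= (f x + f y + d x y) / (2 * Num.sqrt (f x * f y)).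
  exact: ge1_log_ratio.
have ratio_gt0 x y : 0 < (f x + f y + d x y) / (2 * Num.sqrt (f x * f y)).
  exact: lt_le_trans ltr01 _.
split=> [x y|x y|x y|x y z].
- by rewrite mulr_ge0// ln_ge0.
- split=> [/eqP|->].
    rewrite mulf_eq0 pnatr_eq0/= ln_eq0// => /eqP eq1.
    by apply/d_eq0; exact: log_ratio_eq1 eq1.
  rewrite (proj2 (d_eq0 y y) erefl) addr0 -expr2 sqrtr_sqr gtr0_norm//.
  have -> : f y + f y = 2 * f y by ring.
  by rewrite divff ?ln1 ?mulr0// mulf_neq0 ?pnatr_eq0// gt_eqF.
- by rewrite (addrC (f x)) (mulrC (f x)) dC.
- rewrite -mulrDr ler_pM2l// -lnM ?posrE// ler_ln ?posrE//; last exact: mulr_gt0.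
  exact: log_ratioM.
Qed.

End LogRatio.

Theorem corollary3p4 (R : realType) (n : nat) (D : set 'rV[R]_n)
    (alpha : R) (f : D -> R) :
  domain D -> 0 < alpha -> (forall x : D, 0 < f x) -> elipschitz alpha f ->
  is_metric (istar alpha f).
Proof.
move=> _ alpha_gt0 f_gt0 f_lip.
exact: log_ratio_metric (scaled_enorm_metric _ _ D _ alpha_gt0) f_gt0 f_lip.
Qed.
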